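(* Let $X$ be a nonempty set, $I$ a nonempty finite set and $(f_i)_{i\in I}$ a family of functions $f_i:X\to X$. The following two statements are equivalent: I. There exist a metric $D$ on $X$ and a comparison function $\varphi$ such that: a) the metric space $(X,D)$ is complete; b) for every $i\in I$, $f_i$ is a $\varphi$-contraction with respect to $D$. II. There exists a subset $X_1$ of $X$ such that the following four statements are valid: a) $F(X_1)\subseteq X_1$; b) for every $\alpha\in\Lambda(I)$, the set $\bigcap_{n\in\mathbb{N}}(X_1)_{[\alpha]_n}$ has a unique element, which is denoted by $a_\alpha$; c) if $a_\alpha\ne a_\beta$, where $\alpha,\beta\in\Lambda(I)$, then there exists $n_0\in\mathbb{N}$ such that $(X_1)_{[\alpha]_{n_0}}\cap(X_1)_{[\beta]_{n_0}}=\emptyset$; d) for every $x\in X$ there exists $n_x\in\mathbb{N}$ such that $F^{[n_x]}(\{x\})\subseteq X_1$. Here $F:\mathcal{P}(X)\to\mathcal{P}(X)$ is given by $F(C)=\bigcup_{i\in I}f_i(C)$ for every subset $C$ of $X$.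
   Context: $\mathbb{N}=\{0,1,2,\dots\}$ and $\mathbb{N}^*=\{1,2,\dots\}$. $\mathcal{P}(X)$ is the set of all subsets of $X$, and $F^{[n]}$ is the composition of $F$ with itself $n$ times ($F^{[0]}$ is the identity). $\Lambda(I)=I^{\mathbb{N}^*}$ is the set of infinite words $\alpha=\alpha_1\alpha_2\dots$ with letters in $I$. For $\alpha\in\Lambda(I)$ and $n\in\mathbb{N}$, $[\alpha]_n=\alpha_1\dots\alpha_n$ if $n\ge 1$, and $[\alpha]_0=\lambda$ (the empty word). Put $f_\lambda=\mathrm{Id}_X$, $f_{\alpha_1\dots\alpha_m}=f_{\alpha_1}\circ\dots\circ f_{\alpha_m}$, and $(X_1)_\alpha=f_\alpha(X_1)$ for every finite word $\alpha$. Comparison function: a function $\varphi:[0,\infty)\to[0,\infty)$ that is increasing (in the weak sense: $s\le t$ implies $\varphi(s)\le\varphi(t)$), satisfies $\varphi(t)<t$ for every $t>0$, and is right-continuous. $f:X\to X$ is a $\varphi$-contraction with respect to $D$ if $D(f(x),f(y))\le\varphi(D(x,y))$ for all $x,y\in X$. *)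

(* Defs.v *)
From HB Require Import structures.
From mathcomp Require Import all_boot all_order all_algebra.
From mathcomp Require Import all_classical all_reals all_analysis.

Set Implicit Arguments.
Unset Strict Implicit.
Unset Printing Implicit Defensive.

Import Order.TTheory GRing.Theory Num.Theory.
Import numFieldNormedType.Exports.

Local Open Scope classical_set_scope.
Local Open Scope ring_scope.

(* The library's [metricType] bundles the distance with its carrier; here the
   distance is existentially quantified on a fixed carrier, so the metric
   axioms and completeness are predicates on [D]. *)
Record is_metric (R : realType) (X : Type) (D : X -> X -> R) : Prop := {
  metric_ge0 : forall x y, 0 <= D x y;
  metric_eq0 : forall x y, D x y = 0 <-> x = y;
  metric_symm : forall x y, D x y = D y x;
  metric_triangle_ineq : forall x y z, D x z <= D x y + D y z }.

Definition is_cauchy (R : realType) (X : Type) (D : X -> X -> R)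
    (u : nat -> X) : Prop :=
  forall e : R, 0 < e ->
    exists N : nat, forall m n : nat, (N <= m)%N -> (N <= n)%N ->
      D (u m) (u n) < e.

Definition converges_to (R : realType) (X : Type) (D : X -> X -> R)
    (u : nat -> X) (l : X) : Prop :=
  D (u n) l @[n --> \oo] --> (0 : R).

Definition is_complete (R : realType) (X : Type) (D : X -> X -> R) : Prop :=
  forall u : nat -> X, is_cauchy D u -> exists l : X, converges_to D u l.

(* A function [0, oo) -> [0, oo) is represented by [phi : R -> R] mapping
   nonnegative reals to nonnegative reals; its values at negative arguments are
   irrelevant.  The condition at [t^'+] only involves values on [t, oo). *)
Record is_comparison (R : realType) (phi : R -> R) : Prop := {
  comparison_ge0 : forall t, 0 <= t -> 0 <= phi t;
  comparison_homo : forall s t, 0 <= s -> s <= t -> phi s <= phi t;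
  comparison_lt : forall t, 0 < t -> phi t < t;
  comparison_right_continuous :
    forall t, 0 <= t -> phi s @[s --> t^'+] --> phi t }.

Definition is_phi_contraction (R : realType) (X : Type) (D : X -> X -> R)
    (phi : R -> R) (g : X -> X) : Prop :=
  forall x y : X, D (g x) (g y) <= phi (D x y).

Definition hutchinson (X : Type) (I : finType) (f : I -> X -> X)
    (C : set X) : set X :=
  \bigcup_(i in [set: I]) (f i @` C).

(* An infinite word alpha_1 alpha_2 ... is a function [nat -> I], its letter
   alpha_(k+1) being the value at k. *)
Definition infinite_word (I : finType) : Type := nat -> I.

Definition prefix_word (I : finType) (alpha : infinite_word I) (n : nat) :
    seq I :=
  mkseq alpha n.

Definition word_fun (X : Type) (I : finType) (f : I -> X -> X) (w : seq I) :
    X -> X :=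
  foldr (fun i g => f i \o g) id w.

Definition word_image (X : Type) (I : finType) (f : I -> X -> X)
    (X1 : set X) (w : seq I) : set X :=
  word_fun f w @` X1.

(* Main.v *)
Require Import Defs.
From HB Require Import structures.
From mathcomp Require Import all_boot all_order all_algebra.
From mathcomp Require Import all_classical all_reals all_analysis.
From mathcomp Require Import zify ring lra.

(** Write [f_w] for the composite along a finite word [w], and call [f_w X1] a
    cell of order [size w].

    From the metric to the cells.  For a suitable [n], the finite set of the
    points reached from a given point along the words of length [n] is moved so
    little by one more letter that its closed 1-neighbourhood is invariant;
    hence some point [p] has a bounded orbit under all words ([bounded_orbit]).
    Along an infinite word [alpha] the points [f_(alpha_1 ... alpha_n) p] are
    then Cauchy, and their limit is [a alpha].  The limits form a bounded set
    which each [f_i] maps into itself, and [X1] is its closed 1-neighbourhood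
    ([absorbing_set]): the diameter of a cell of order [n] is at most the
    [n]-th iterate of [phi] at the diameter of [X1], which tends to 0, and the
    other clauses follow.

    From the cells to the metric.  Call two points of [X] [n]-close when they
    are equal or lie in two cells of order [n] that meet.  Compactness of the
    space of infinite words and the separation clause make these relations a
    base of a separated complete uniformity ([cell_close_split],
    [cell_close_separated], [cell_close_complete]).  It has a countable base,
    hence a bounded metric [rho].  The maps [f_i] send [n]-close points to
    [n.+1]-close ones, but [rho] need not see that.  So [rho x y] is replaced by
    the supremum over all words [w] of [b_(size w) * rho (f_w x) (f_w y)], where
    the weights [b_n] increase strictly within [[1, 2]].  Applying [f_i]
    lengthens every word by one letter, so each new term is at most
    [b_n / b_(n+1)] times the original supremum; long words contribute little,
    so finitely many of these factors, all less than 1, decide how much a given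
    distance decreases ([weighted_orbit_distance]).
    This works on [X1] only.  For distinct points not both in [X1] the time
    needed to enter [X1] is added to the distance: it drops by at least one
    at each step until it vanishes ([entrance_distance]).  The system then decreases
    distances strictly, and uniformly near each positive value, which is just
    what a comparison function expresses ([comparison_of_strict_decrease]). *)

Set Implicit Arguments.
Unset Strict Implicit.
Unset Printing Implicit Defensive.

Import Order.TTheory GRing.Theory Num.Theory.
Import numFieldNormedType.Exports.

Local Open Scope classical_set_scope.
Local Open Scope ring_scope.

(** * Finite trees and words *)

(** The weak König lemma, which is how the compactness of the space of infinite
    words enters.  The branch is grown inside the words that have extensions of
    every length in [T]: as the alphabet is finite, one of the one-letter
    extensions of such a word has the same property. *)
Lemma infinite_branch (J : finType) (T : set (seq J)) :
  (forall n w, T w -> T (take n w)) ->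
  (forall n, exists2 w, size w = n & T w) ->
  exists alpha : infinite_word J, forall n, T (prefix_word alpha n).
Proof.
move=> Ttake Tsize.
pose big w := forall n, exists2 v, size v = n & T (w ++ v).
have Tcut u v : T (u ++ v) -> T u.
  by move=> /(Ttake (size u)); rewrite take_size_cat.
have step w : big w -> exists j, big (rcons w j).
  move=> bigw; apply: contrapT => /forallNP nbig.
  have /choice[N NP] (j : J) :
      exists n, forall v, size v = n -> ~ T (rcons w j ++ v).
    have /existsNP[n nP] := nbig j.
    by exists n => v sv Tv; apply: nP; exists v.
  have [[//|j v] /= [sv]] := bigw (\max_j N j).+1.
  rewrite -cat_rcons => Tv; apply: (NP j (take (N j) v)).
    by rewrite size_takel // sv; exact: leq_bigmax.
  by apply: (Tcut _ (drop (N j) v)); rewrite -catA cat_take_drop.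
have [j0] : exists j : J, True.
  by have [[|j w] //] := Tsize 1; exists j.
move=> _.
have /choice[next nextP] (w : seq J) : exists j, big w -> big (rcons w j).
  have [/step[j bigj]|nb] := pselect (big w); first by exists j.
  by exists j0.
pose W n := iter n (fun w => rcons w (next w)) [::].
exists (next \o W) => n.
have -> : prefix_word (next \o W) n = W n.
  by elim: n => // n IH; rewrite /prefix_word mkseqS -/(prefix_word _ _) IH.
have /(_ 0)[[]//] : big (W n).
  elim: n => [|n IH]; last exact: nextP.
  by move=> n; have [w sw Tw] := Tsize n; exists w.
by rewrite cats0.
Qed.

Section words.
Context {X : Type} {I : finType} (f : I -> X -> X).
Implicit Types (w u v : seq I) (alpha : infinite_word I) (A : set X).

Lemma word_fun_cat u v x : word_fun f (u ++ v) x = word_fun f u (word_fun f v x).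
Proof. by elim: u => //= i u ->. Qed.

Lemma word_fun_rcons u i x : word_fun f (rcons u i) x = word_fun f u (f i x).
Proof. by rewrite -cats1 word_fun_cat. Qed.

Lemma take_prefix_word n m alpha :
  (n <= m)%N -> take n (prefix_word alpha m) = prefix_word alpha n.
Proof.
by move=> nm; rewrite /prefix_word /mkseq -map_take take_iota (minn_idPl nm).
Qed.

Lemma prefix_wordS n alpha :
  prefix_word alpha n.+1 = alpha 0%N :: prefix_word (alpha \o succn) n.
Proof.
rewrite /prefix_word /mkseq /= -[1%N]/(1 + 0)%N iotaDl -map_comp.
by congr cons.
Qed.

Lemma iter_hutchinson n A :
  iter n (hutchinson f) A = [set y | exists2 w, size w = n & word_image f A w y].
Proof.
elim: n => [|n IH] /=; apply/seteqP; split => y.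
- by move=> Ay; exists [::] => //; exists y.
- by move=> [w /size0nil -> [x Ax <-]].
- move=> [i _ [z]]; rewrite IH => -[w sw [x Ax <-]] <-.
  by exists (i :: w); rewrite /= ?sw //; exists x.
- move=> [[//|i w] /= [sw] [x Ax <-]]; exists i => //.
  by exists (word_fun f w x) => //; rewrite IH; exists w => //; exists x.
Qed.

Lemma word_fun_invariant A w x :
  hutchinson f A `<=` A -> A x -> A (word_fun f w x).
Proof.
move=> FA Ax; elim: w => //= i w IH.
by apply: FA; exists i => //; exists (word_fun f w x).
Qed.

Lemma word_image_cat A u v :
  hutchinson f A `<=` A -> word_image f A (u ++ v) `<=` word_image f A u.
Proof.
move=> FA y [x Ax <-]; exists (word_fun f v x).
  exact: word_fun_invariant.
by rewrite word_fun_cat.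
Qed.

Lemma word_image_take A n w :
  hutchinson f A `<=` A -> word_image f A w `<=` word_image f A (take n w).
Proof.
by move=> FA; rewrite -{1}[w](cat_take_drop n); exact: word_image_cat.
Qed.

End words.

(** * The uniformity of touching cells *)

Section cells.
Context {X : Type} {I : finType} (f : I -> X -> X).
Context (X1 : set X) (a : infinite_word I -> X).
Hypothesis X1_invariant : hutchinson f X1 `<=` X1.
Hypothesis cellsE : forall alpha : infinite_word I,
  \bigcap_(n in [set: nat]) word_image f X1 (prefix_word alpha n) = [set a alpha].
Hypothesis cells_separate : forall alpha beta : infinite_word I,
  a alpha <> a beta -> exists n0 : nat,
    word_image f X1 (prefix_word alpha n0) `&`
    word_image f X1 (prefix_word beta n0) = set0.

Let cell w := word_image f X1 w.

Definition touching (u v : seq I) : Prop :=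
  word_image f X1 u `&` word_image f X1 v !=set0.

(** Lying in one common cell would not be transitive, even up to a loss of
    order: cells that meet, such as the halves of an interval, need not lie in
    a common cell of any comparable order.  Equality is included because a
    point may lie in no cell of order [n]. *)
Definition cell_close (n : nat) (x y : X) : Prop :=
  x = y \/ exists u v : seq I, [/\ size u = n, size v = n, touching u v,
    word_image f X1 u x & word_image f X1 v y].

Lemma touching_sym u v : touching u v -> touching v u.
Proof. by rewrite /touching setIC. Qed.

Lemma touching_common u v x : cell u x -> cell v x -> touching u v.
Proof. by exists x. Qed.

Lemma touching_take n u v : touching u v -> touching (take n u) (take n v).
Proof.
by move=> [x [ux vx]]; exists x; split; apply: word_image_take.
Qed.

Lemma cell_address alpha n : cell (prefix_word alpha n) (a alpha).
Proof.
by have : [set a alpha] (a alpha) by []; rewrite -cellsE; exact.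
Qed.

Lemma eq_address alpha x :
  (forall n, cell (prefix_word alpha n) x) -> x = a alpha.
Proof.
by move=> xP; have : [set a alpha] x by rewrite -cellsE => n _; exact: xP.
Qed.

Lemma eq_address_touching alpha beta :
  (forall n, touching (prefix_word alpha n) (prefix_word beta n)) ->
  a alpha = a beta.
Proof.
move=> ab; apply: contrapT => /cells_separate[n abn].
by have := ab n; rewrite /touching abn => -[].
Qed.

(** Touching is transitive up to a loss of order.  Otherwise the failing triples
    of words have, by compactness, an infinite branch: three infinite words
    whose prefixes touch consecutively at every order, so that they have the
    same point [a], which then lies in the first and in the third cell. *)
Lemma touching_trans n : exists2 m, (n <= m)%N & forall u v w,
  size u = m -> size v = m -> size w = m ->
  touching u v -> touching v w -> touching (take n u) (take n w).
Proof.
apply: contrapT => /forall2NP bad.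
pose p1 (t : I * I * I) := t.1.1; pose p2 (t : I * I * I) := t.1.2.
pose p3 (t : I * I * I) := t.2.
(* Non-touching is inherited by longer words only; it is imposed on words of
   length at least [n] so that [T] is closed under prefixes. *)
pose T (s : seq (I * I * I)) := [/\ touching (map p1 s) (map p2 s),
  touching (map p2 s) (map p3 s) &
  (n <= size s)%N -> ~ touching (take n (map p1 s)) (take n (map p3 s))].
have Ttake k s : T s -> T (take k s).
  move=> [t12 t23 t13]; split; rewrite ?map_take; try exact: touching_take.
  rewrite size_take_min leq_min => /andP[nk ns].
  by rewrite !take_takel //; exact: t13.
have [|alpha alphaP] := @infinite_branch _ T Ttake.
  move=> m; have [|] := bad (maxn n m); first by rewrite leq_maxl.
  set K := maxn n m => /existsNP[u /existsNP[v /existsNP[w bad_uvw]]].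
  move/not_implyP: bad_uvw => [su /not_implyP[sv /not_implyP[sw]]].
  move=> /not_implyP[uv /not_implyP[vw uw]].
  pose s := zip (zip u v) w.
  have s12 : size (zip u v) = K by rewrite size_zip su sv minnn.
  have e12 : map fst s = zip u v.
    by rewrite -[map _ _]/(unzip1 _) unzip1_zip // s12 sw.
  have e1 : map p1 s = u.
    by rewrite (map_comp fst fst) e12 -[map _ _]/(unzip1 _) unzip1_zip // su sv.
  have e2 : map p2 s = v.
    by rewrite (map_comp snd fst) e12 -[map _ _]/(unzip2 _) unzip2_zip // su sv.
  have e3 : map p3 s = w.
    by rewrite -[map _ _]/(unzip2 _) unzip2_zip // s12 sw.
  exists (take m s); last by apply: Ttake; split; rewrite ?e1 ?e2 ?e3.
  by rewrite size_takel // size_zip s12 sw minnn leq_maxr.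
have mapP p k : map p (prefix_word alpha k) = prefix_word (p \o alpha) k :> seq I.
  by rewrite /prefix_word /mkseq -map_comp.
have e12 : a (p1 \o alpha) = a (p2 \o alpha).
  by apply: eq_address_touching => k; rewrite -!mapP; have [] := alphaP k.
have e23 : a (p2 \o alpha) = a (p3 \o alpha).
  by apply: eq_address_touching => k; rewrite -!mapP; have [] := alphaP k.
have [_ _] := alphaP n; rewrite size_mkseq => /(_ (leqnn n)); apply.
rewrite !mapP !take_oversize ?size_mkseq //.
apply: (@touching_common _ _ (a (p1 \o alpha))); first exact: cell_address.
by rewrite e12 e23; exact: cell_address.
Qed.

Lemma cell_close_sym n x y : cell_close n x y -> cell_close n y x.
Proof.
by move=> [->|[u [v [su sv /touching_sym vu ux vy]]]]; [left|right; exists v, u].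
Qed.

Lemma cell_close_mono m n x y : (m <= n)%N -> cell_close n x y -> cell_close m x y.
Proof.
move=> mn [->|[u [v [su sv uv ux vy]]]]; first by left.
right; exists (take m u), (take m v); split.
- by rewrite size_takel // su.
- by rewrite size_takel // sv.
- exact: touching_take.
- exact: word_image_take.
- exact: word_image_take.
Qed.

(** The four cells containing [x], [y], [y], [z] form a chain of three contacts,
    the middle one at [y]; hence two uses of [touching_trans]. *)
Lemma cell_close_split n : exists m, forall x y z,
  cell_close m x y -> cell_close m y z -> cell_close n x z.
Proof.
have [k nk kP] := touching_trans n; have [m km mP] := touching_trans k.
have nm : (n <= m)%N by exact: leq_trans km.
exists m => x y z [->|]; first exact: cell_close_mono nm.
move=> xy [<-|]; first by apply: cell_close_mono nm _; right.
move: xy => [u [v [su sv uv ux vy]]] [u' [v' [su' sv' uv' uy vz]]].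
right; exists (take n u), (take n v'); split.
- by rewrite size_takel // su.
- by rewrite size_takel // sv'.
- rewrite -(take_takel u nk) -(take_takel v' nk).
  apply: (kP _ (take k u')); rewrite ?size_takel ?su ?su' ?sv' //.
    exact: (mP _ v) (touching_common vy uy).
  exact: touching_take.
- exact: word_image_take.
- exact: word_image_take.
Qed.

(** The source of all contraction: a map of the system raises the order of
    closeness by one. *)
Lemma cell_close_word_fun n w x y :
  cell_close n x y -> cell_close (size w + n) (word_fun f w x) (word_fun f w y).
Proof.
have image u z : cell u z -> cell (w ++ u) (word_fun f w z).
  by move=> [t X1t <-]; exists t => //; rewrite word_fun_cat.
move=> [->|[u [v [su sv [z [uz vz]] ux vy]]]]; first by left.
right; exists (w ++ u), (w ++ v); split; rewrite ?size_cat ?su ?sv //.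
- by exists (word_fun f w z); split; exact: image.
- exact: image.
- exact: image.
Qed.

Lemma cell_close0 x y : cell_close 0 x y <-> x = y \/ X1 x /\ X1 y.
Proof.
split=> [[->|[_ [_ [/size0nil-> /size0nil-> _ [s X1s <-] [t X1t <-]]]]]|].
- by left.
- by right.
move=> [->|[X1x X1y]]; first by left.
have cell0 z : X1 z -> cell [::] z by exists z.
right; exists [::], [::]; split; rewrite -/(cell _) //; try exact: cell0.
by exists x; split; exact: cell0.
Qed.

(** The pairs of cells witnessing closeness at the various orders need not be
    nested; compactness provides two infinite words all of whose cells contain
    [x], respectively [y], and touch. *)
Lemma cell_close_separated x y : (forall n, cell_close n x y) -> x = y.
Proof.
move=> cell_closexy; apply: contrapT => xy.
pose T (s : seq (I * I)) := [/\ touching (map fst s) (map snd s),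
  cell (map fst s) x & cell (map snd s) y].
have [||alpha alphaP] := @infinite_branch _ T.
- move=> k s [t12 cx cy]; split; rewrite ?map_take; first exact: touching_take.
    exact: word_image_take.
  exact: word_image_take.
- move=> n; have [//|[u [v [su sv uv ux vy]]]] := cell_closexy n.
  have e1 : map fst (zip u v) = u.
    by rewrite -[map _ _]/(unzip1 _) unzip1_zip // su sv.
  have e2 : map snd (zip u v) = v.
    by rewrite -[map _ _]/(unzip2 _) unzip2_zip // su sv.
  exists (zip u v); first by rewrite size_zip su sv minnn.
  by split; rewrite ?e1 ?e2.
have mapP p k : map p (prefix_word alpha k) = prefix_word (p \o alpha) k :> seq I.
  by rewrite /prefix_word /mkseq -map_comp.
apply: xy; rewrite (@eq_address (fst \o alpha) x); last first.
  by move=> n; rewrite -mapP; have [] := alphaP n.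
rewrite (@eq_address (snd \o alpha) y); last first.
  by move=> n; rewrite -mapP; have [] := alphaP n.
by apply: eq_address_touching => n; rewrite -!mapP; have [] := alphaP n.
Qed.

(** A Cauchy sequence that is not eventually constant keeps visiting cells of
    every order; by compactness it visits infinitely often all the cells of one
    infinite word [alpha], and it converges to [a alpha]. *)
Lemma cell_close_complete (u : nat -> X) :
  (forall n, exists N, forall k l, (N <= k)%N -> (N <= l)%N ->
    cell_close n (u k) (u l)) ->
  exists l, forall n, exists N, forall k, (N <= k)%N -> cell_close n (u k) l.
Proof.
move=> u_cauchy.
have [[N uN]|moving] :=
    pselect (exists N, forall k, (N <= k)%N -> u k = u N).
  by exists (u N) => n; exists N => k /uN ->; left.
pose often w := forall N, exists2 k, (N <= k)%N & cell w (u k).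
have [||alpha alphaP] := @infinite_branch _ often.
- move=> n w oft N; have [k Nk wk] := oft N; exists k => //.
  exact: word_image_take.
- move=> n; apply: contrapT => /forall2NP none.
  have /choice[N NP] (t : n.-tuple I) :
      exists N, forall k, (N <= k)%N -> ~ cell t (u k).
    have [|/existsNP[N noneN]] := none t; first by rewrite size_tuple.
    by exists N => k Nk tk; apply: noneN; exists k.
  have [M MP] := u_cauchy n.
  pose K := maxn M (\max_t N t).
  apply: moving; exists K => k Kk.
  have MK : (M <= K)%N by exact: leq_maxl.
  have [//|[w [_ [/eqP sw _ _ wk _]]]] := MP k K (leq_trans MK Kk) MK.
  have [] := NP (Tuple sw) k _ wk; apply: leq_trans Kk.
  by rewrite leq_max (leq_bigmax (Tuple sw)) orbT.
exists (a alpha) => n; have [m mP] := cell_close_split n.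
have [N NP] := u_cauchy m; exists N => k Nk.
have [l Nl cl] := alphaP m N.
apply: mP (NP k l Nk Nl) _.
right; exists (prefix_word alpha m), (prefix_word alpha m).
rewrite size_mkseq; split => //; last exact: cell_address.
by exists (u l).
Qed.

End cells.

(** * Metrization of a countable decreasing family of relations *)

Section metrization.
Context (R : realType) (T : Type) (V : nat -> T -> T -> Prop).
Hypothesis V_refl : forall n x, V n x x.
Hypothesis V_sym : forall n x y, V n x y -> V n y x.
Hypothesis V_mono : forall m n x y, (m <= n)%N -> V n x y -> V m x y.
Hypothesis V_split : forall n, exists m, forall x y z,
  V m x y -> V m y z -> V n x z.

Let V_entourage : set_system (T * T) :=
  [set E | exists n, [set xy | V n xy.1 xy.2] `<=` E].

Local Open Scope relation_scope.

Let V_entourage_filter : Filter V_entourage.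
Proof.
split; first by exists 0%N.
- move=> P Q [m mP] [n nQ]; exists (maxn m n) => xy Vxy; split.
    by apply: mP; apply: V_mono Vxy; exact: leq_maxl.
  by apply: nQ; apply: V_mono Vxy; exact: leq_maxr.
- by move=> P Q PQ [n nP]; exists n; exact: subset_trans nP PQ.
Qed.

Let V_entourage_diagonal E : V_entourage E -> diagonal `<=` E.
Proof. by move=> [n nE] [x y]; rewrite /diagonal /= => ->; apply: nE; exact: V_refl. Qed.

Let V_entourage_inv E : V_entourage E -> V_entourage E^-1.
Proof. by move=> [n nE]; exists n => -[x y] /= /V_sym ?; exact: (nE (y, x)). Qed.

Let V_entourage_split E :
  V_entourage E -> exists2 B, V_entourage B & B \; B `<=` E.
Proof.
move=> [n nE]; have [m Vm] := V_split n.
exists [set xy | V m xy.1 xy.2]; first by exists m.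
by move=> [x z] [y Vxy Vyz]; apply: nE; exact: Vm Vxy Vyz.
Qed.

Local Close Scope relation_scope.

(** The relations are a base of a uniformity, and a uniformity with a countable
    base comes from a family of balls in which every ball of radius 2 is the
    whole space.  So the associated extended distance takes values in
    [[0, 2]]. *)
Lemma metrization : exists rho : T -> T -> R,
  [/\ forall x y, 0 <= rho x y <= 2, forall x, rho x x = 0,
      forall x y, rho x y = rho y x,
      forall x y z, rho x z <= rho x y + rho y z &
      (forall n, exists2 e, 0 < e & forall x y, rho x y < e -> V n x y) /\
      (forall e, 0 < e -> exists n, forall x y, V n x y -> rho x y <= e)].
Proof.
pose C := HB.pack_for choiceType T (gen_eqMixin T) (gen_choiceMixin T).
pose U := HB.pack_for uniformType T (gen_eqMixin T) (gen_choiceMixin T)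
  (isUniform.Build C V_entourage_filter V_entourage_diagonal
    V_entourage_inv V_entourage_split).
have Uent : @entourage U = V_entourage by [].
have cU : countable_uniformity U.
  apply/countable_uniformityP; exists (fun n => [set xy | V n xy.1 xy.2]).
    by move=> E; rewrite Uent.
  by move=> n; rewrite Uent; exists n.
pose M : pseudoMetricType R := countable_uniform.type cU.
have ball2 (x y : M) : ball x (2 : R) y.
  exact: countable_uniform.countable_uniform_bounded.
have fin (x y : M) : @edist R M (x, y) \is a fin_num.
  by apply/edist_finP; exists 2.
have ent : entourage_ (@ball R M) = V_entourage by rewrite entourage_ballE.
exists (fun x y => fine (@edist R M (x, y))).
split.
- move=> x y; rewrite -!lee_fin fineK // edist_ge0 /=.
  exact: (@edist_fin _ M 2 (x, y)).
- by move=> x; rewrite edist_refl.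
- by move=> x y; rewrite edist_sym.
- by move=> x y z; rewrite -lee_fin EFinD !fineK //; exact: edist_triangle.
- split=> [n|e e0].
    have [e e0 eV] : entourage_ (@ball R M) [set xy | V n xy.1 xy.2].
      by rewrite ent; exists n.
    exists e => // x y; rewrite -lte_fin fineK // => /edist_lt_ball.
    by move=> /(eV (x, y)).
  have [n nV] : V_entourage [set xy | @ball R M xy.1 e xy.2].
    by rewrite -ent; exists e.
  exists n => x y Vxy; rewrite -lee_fin fineK //.
  by apply: (@edist_fin _ M e (x, y)) => //; exact: (nV (x, y)).
Qed.
End metrization.

(** * Comparison functions from uniform strict contractivity *)

(** The function [phi t] is the infimum of the numbers [r] such that the maps
    send all pairs at distance less than [t + d], for some [d > 0], to distance
    at most [r].  The room left by [d] makes every such [r] admissible for all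
    nearby larger [t], whence right continuity. *)
Lemma comparison_of_strict_decrease (R : realType) (X I : Type)
    (D : X -> X -> R) (f : I -> X -> X) :
  (forall x y, 0 <= D x y) ->
  (forall t, 0 < t -> exists2 r, r < t & exists2 d, 0 < d &
     forall i x y, D x y < t + d -> D (f i x) (f i y) <= r) ->
  exists phi : R -> R,
    is_comparison phi /\ forall i, is_phi_contraction D phi (f i).
Proof.
move=> D_ge0 decr.
pose B t r := exists2 d, 0 < d &
  forall i x y, D x y < t + d -> D (f i x) (f i y) <= r.
pose S t := [set r | 0 <= r /\ B t r].
have S_lb t : has_lbound (S t) by exists 0 => r [].
have S_neq0 t : 0 <= t -> S t !=set0.
  move=> t0; have [r _ [d d0 rP]] := decr _ (ltr_wpDl t0 ltr01).
  exists (Num.max 0 r); split; first by rewrite le_max lexx.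
  exists 1 => // i x y Dt; rewrite le_max; apply/orP; right; apply: rP.
  by rewrite (lt_trans Dt) // ltrDl.
have infS t r : S t r -> inf (S t) <= r by exact: ge_inf.
have S_homo s t : s <= t -> S t `<=` S s.
  move=> st r [r0 [d d0 rP]]; split=> //; exists d => // i x y Ds.
  by apply: rP; apply: lt_le_trans Ds _; rewrite lerD2r.
have phi_homo s t : 0 <= s -> s <= t -> inf (S s) <= inf (S t).
  move=> s0 st; apply: lb_le_inf; first by apply: S_neq0; exact: le_trans st.
  by move=> r /(S_homo s t st); exact: ge_inf.
exists (fun t => inf (S t)); split; last first.
  move=> i x y; apply: lb_le_inf; first exact: S_neq0.
  by move=> r [_ [d d0]]; apply; rewrite ltrDl.
split=> //.
- by move=> t t0; apply: lb_le_inf; [exact: S_neq0|move=> r []].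
- move=> t t0; have [r rt [d d0 rP]] := decr t t0.
  have /le_lt_trans : inf (S t) <= Num.max 0 r.
    apply: infS; split; first by rewrite le_max lexx.
    by exists d => // i x y /rP Dr; rewrite le_max Dr orbT.
  by apply; rewrite gt_max t0.
- move=> t t0; apply/cvgrPdist_lt => e e0.
  have [r [r0 [d d0 rP]] re] := inf_adherent e0 (conj (S_neq0 t t0) (S_lb t)).
  near=> s.
  have ts : t < s by near: s; exact: nbhs_right_gt.
  have sd : s < t + d by near: s; apply: nbhs_right_lt; rewrite ltrDl.
  have s0 : 0 <= s by exact: le_trans (ltW ts).
  rewrite ltr_norml; apply/andP; split; last first.
    by apply: le_lt_trans e0; rewrite subr_le0; exact: phi_homo (ltW ts).
  rewrite ltrNl opprB ltrBlDl; apply: le_lt_trans re.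
  apply: infS; split=> //; exists (t + d - s); first by rewrite subr_gt0.
  by move=> i x y; rewrite addrC subrK; exact: rP.
Unshelve. all: by end_near.
Qed.

(** * Remetrization *)

Section remetrization.
Context {R : realType} {X : Type} {I : finType} (f : I -> X -> X).
Context (X1 : set X) (a : infinite_word I -> X).
Hypothesis X1_invariant : hutchinson f X1 `<=` X1.
Hypothesis cellsE : forall alpha : infinite_word I,
  \bigcap_(n in [set: nat]) word_image f X1 (prefix_word alpha n) = [set a alpha].
Hypothesis cells_separate : forall alpha beta : infinite_word I,
  a alpha <> a beta -> exists n0 : nat,
    word_image f X1 (prefix_word alpha n0) `&`
    word_image f X1 (prefix_word beta n0) = set0.
Hypothesis X1_absorbing : forall x : X, exists n : nat,
  iter n (hutchinson f) [set x] `<=` X1.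

Lemma entrance_time : exists h : X -> nat,
  (forall x, h x = 0%N -> X1 x) /\ (forall x, X1 x -> h x = 0%N) /\
  (forall i x, (h (f i x) <= (h x).-1)%N).
Proof.
pose P x n := `[< forall w, size w = n -> X1 (word_fun f w x) >].
have exP x : exists n, P x n.
  have [n nP] := X1_absorbing x; exists n; apply/asboolP => w sw; apply: nP.
  by rewrite iter_hutchinson; exists w => //; exists x.
exists (fun x => ex_minn (exP x)); split; [|split].
- move=> x; case: ex_minnP => n + _ n0; rewrite n0 => /asboolP xP.
  exact: (xP [::]).
- move=> x X1x; case: ex_minnP => n _ /(_ 0%N) n_min.
  apply/eqP; rewrite -leqn0; apply: n_min; apply/asboolP => w /size0nil ->.
  exact: X1x.
move=> i x; case: ex_minnP => m _ m_min; case: ex_minnP => -[|n] /asboolP nP _ /=.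
  apply: m_min; apply/asboolP => w /size0nil -> /=.
  by apply: X1_invariant; exists i => //; exists x => //; exact: (nP [::]).
apply: m_min; apply/asboolP => w sw; rewrite -word_fun_rcons; apply: nP.
by rewrite size_rcons sw.
Qed.

(** For distinct points the value is the larger of the two entrance times.  It
    vanishes exactly on the pairs that are 0-close, that is, equal or both in
    [X1]. *)
Lemma entrance_distance : exists E : X -> X -> nat,
  [/\ forall x y, E x y = E y x,
      forall x y z, (E x z <= E x y + E y z)%N,
      forall i x y, (E (f i x) (f i y) <= (E x y).-1)%N &
      forall x y, E x y = 0%N <-> cell_close f X1 0 x y].
Proof.
have [h [h0_X1 [X1_h0 h_dec]]] := entrance_time.
have [E E_refl E_neq] : exists2 E : X -> X -> nat, forall x, E x x = 0%N &
    forall x y, x <> y -> E x y = maxn (h x) (h y).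
  exists (fun x y => if `[< x = y >] then 0%N else maxn (h x) (h y)) => [x|x y xy].
    by case: asboolP.
  by case: asboolP.
exists E; split.
- move=> x y; have [->//|xy] := pselect (x = y).
  by rewrite (E_neq _ _ xy) (E_neq _ _ (nesym xy)) maxnC.
- move=> x y z; have [->|xz] := pselect (x = z); first by rewrite E_refl.
  have [->|xy] := pselect (x = y); first by rewrite E_refl.
  have [<-|yz] := pselect (y = z); first by rewrite leq_addr.
  rewrite (E_neq _ _ xy) (E_neq _ _ yz) (E_neq _ _ xz); lia.
- move=> i x y; have [->|fxy] := pselect (f i x = f i y); first by rewrite E_refl.
  have xy : x <> y by move=> xy; apply: fxy; rewrite xy.
  rewrite (E_neq _ _ xy) (E_neq _ _ fxy).
  by have := h_dec i x; have := h_dec i y; lia.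
move=> x y; split=> [|/cell_close0[->|[/X1_h0 hx /X1_h0 hy]]].
- have [->|xy] := pselect (x = y); first by left.
  rewrite (E_neq _ _ xy) => /eqP; rewrite -leqn0 geq_max !leqn0.
  by move=> /andP[/eqP /h0_X1 X1x /eqP /h0_X1 X1y]; apply/cell_close0; right.
- exact: E_refl.
- have [->|xy] := pselect (x = y); first exact: E_refl.
  by rewrite (E_neq _ _ xy) hx hy.
Qed.

Let b (n : nat) : R := 2 - 2^-1 ^+ n.

Let half_gt0 n : 0 < 2^-1 ^+ n :> R. Proof. by rewrite exprn_gt0. Qed.

Let half_anti m n : (m <= n)%N -> 2^-1 ^+ n <= 2^-1 ^+ m :> R.
Proof. by move=> mn; rewrite ler_wiXn2l // invf_le1 // ler1n. Qed.

Let b_ge1 n : 1 <= b n.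
Proof.
have := half_anti (leq0n n); rewrite expr0 /b; lra.
Qed.

Let b_le2 n : b n <= 2. Proof. by have := half_gt0 n; rewrite /b; lra. Qed.

(** For words shorter than [N], one more letter multiplies the weight by a factor
    that exceeds 1 by an amount depending on [N] alone. *)
Let b_step n N : (n < N)%N -> b n <= (1 - 2^-1 ^+ N.+1) * b n.+1.
Proof.
move=> nN; have := half_anti nN; rewrite /b !exprS.
have := half_gt0 n; have := half_gt0 N; set p := _ ^+ n; set q := _ ^+ N.
move=> q0 p0 qp.
have := mulr_ge0 (ltW q0) (ltW p0); lra.
Qed.

(** In the last clause, a term of [D1 (f i x) (f i y)] indexed by [w] is compared
    with the term of [D1 x y] indexed by [rcons w i].  For short [w] the weights
    give a factor [1 - p] that depends on [e] alone; for long [w] the images are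
    so close that the term is below [e]. *)
Lemma weighted_orbit_distance : exists D1 : X -> X -> R,
  [/\ [/\ forall x y, 0 <= D1 x y, forall x, D1 x x = 0,
          forall x y, D1 x y = D1 y x &
          forall x y z, D1 x z <= D1 x y + D1 y z],
      forall n, exists2 e, 0 < e &
        forall x y, D1 x y < e -> cell_close f X1 n x y,
      forall e, 0 < e -> exists n,
        forall x y, cell_close f X1 n x y -> D1 x y <= e,
      forall i x y, D1 (f i x) (f i y) <= D1 x y &
      forall e, 0 < e -> exists2 p, 0 < p <= 1 & forall i x y,
        cell_close f X1 0 x y ->
        D1 (f i x) (f i y) <= Num.max ((1 - p) * D1 x y) e].
Proof.
have [||||rho [rho_bound rho_refl rho_sym rho_triangle [rho_close close_rho]]] :=
  @metrization R X (cell_close f X1).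
- by left.
- by move=> n x y; exact: cell_close_sym.
- by move=> m n x y; exact: cell_close_mono.
- by move=> n; exact: cell_close_split.
have rho_ge0 x y : 0 <= rho x y by have /andP[] := rho_bound x y.
have rho_le2 x y : rho x y <= 2 by have /andP[] := rho_bound x y.
have close_word n w x y : cell_close f X1 n x y ->
    cell_close f X1 n (word_fun f w x) (word_fun f w y).
  move=> xy; apply: (cell_close_mono X1_invariant _ (cell_close_word_fun w xy)).
  exact: leq_addl.
pose G x y := [set b (size w) * rho (word_fun f w x) (word_fun f w y)
  | w in [set: seq I]].
have G_neq0 x y : G x y !=set0 by exists (b 0 * rho x y); exists [::].
have G_ub x y : has_ubound (G x y).
  exists (2 * 2) => _ [w _ <-]; apply: ler_pM => //; exact: le_trans (b_ge1 _).
pose D1 x y := sup (G x y).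
have D1_term w x y :
    b (size w) * rho (word_fun f w x) (word_fun f w y) <= D1 x y.
  by apply: ub_le_sup => //; exists w.
have D1_le x y c :
    (forall w, b (size w) * rho (word_fun f w x) (word_fun f w y) <= c) ->
    D1 x y <= c.
  by move=> ub; apply: ge_sup => // _ [w _ <-].
have D1_rho x y : rho x y <= D1 x y.
  by have := D1_term [::] x y; rewrite /= /b expr0 (_ : 2 - 1 = 1 :> R) ?mul1r //; lra.
have D1_ge0 x y : 0 <= D1 x y by exact: le_trans (D1_rho x y).
have D1_nonexp i x y : D1 (f i x) (f i y) <= D1 x y.
  apply: D1_le => w; apply: le_trans (D1_term (rcons w i) x y).
  rewrite !word_fun_rcons size_rcons ler_wpM2r // lerD2l lerN2.
  exact: half_anti.
have close_D1 e : 0 < e ->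
    exists n, forall x y, cell_close f X1 n x y -> D1 x y <= e.
  move=> e0; have [|n nP] := close_rho (e / 2); first by rewrite divr_gt0.
  exists n => x y /close_word close_xy; apply: D1_le => w.
  rewrite (_ : e = 2 * (e / 2)); last by rewrite mulrC divfK.
  by apply: ler_pM => //; [exact: le_trans (b_ge1 _)|exact/nP/close_xy].
have D1_triangle x y z : D1 x z <= D1 x y + D1 y z.
  apply: D1_le => w; apply: le_trans (lerD (D1_term w x y) (D1_term w y z)).
  by rewrite -mulrDr ler_wpM2l //; exact: le_trans (b_ge1 _).
have D1_sym x y : D1 x y = D1 y x.
  by rewrite /D1 /G; congr sup; apply: eq_imagel => w _; rewrite rho_sym.
exists D1; split=> //.
- split=> // x; apply/eqP; rewrite eq_le D1_ge0 andbT.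
  by apply: D1_le => w; rewrite rho_refl mulr0.
- move=> n; have [e e0 eP] := rho_close n; exists e => // x y.
  by move=> /(le_lt_trans (D1_rho x y)); exact: eP.
move=> e e0; have [|N NP] := close_rho (e / 2); first by rewrite divr_gt0.
exists (2^-1 ^+ N.+1) => [|i x y xy].
  by rewrite half_gt0 -[leRHS](expr0 2^-1) half_anti.
apply: D1_le => w; rewrite -!word_fun_rcons le_max.
have [wN|Nw] := ltnP (size w) N; apply/orP; [left|right].
  apply: le_trans (ler_wpM2r (rho_ge0 _ _) (b_step wN)) _.
  rewrite -mulrA -(size_rcons w i) ler_wpM2l // subr_ge0.
  by rewrite -[leRHS](expr0 2^-1) half_anti.
rewrite (_ : e = 2 * (e / 2)); last by rewrite mulrC divfK.
apply: ler_pM => //; first exact: le_trans (b_ge1 _).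
apply: NP.
apply: (cell_close_mono X1_invariant _ (cell_close_word_fun (rcons w i) xy)).
by rewrite addn0 size_rcons ltnW.
Qed.

Lemma remetrization : exists D : X -> X -> R, exists phi : R -> R,
  [/\ is_metric D, is_comparison phi, is_complete D &
      forall i, is_phi_contraction D phi (f i)].
Proof.
have [D1 [[D1_ge0 D1_refl D1_sym D1_triangle] D1_close close_D1
  D1_nonexp D1_contr]] := weighted_orbit_distance.
have [E [E_sym E_triangle E_dec E_close]] := entrance_distance.
pose D x y := D1 x y + (E x y)%:R.
have D1_leD x y : D1 x y <= D x y by rewrite lerDl.
have D_metric : is_metric D.
  split.
  - by move=> x y; rewrite addr_ge0.
  - move=> x y; split=> [Dxy|->].
      apply: (cell_close_separated X1_invariant cellsE cells_separate) => n.
      have [e e0] := D1_close n; apply.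
      by apply: le_lt_trans e0; rewrite -Dxy.
    by rewrite /D D1_refl (E_close y y).2 ?addr0 //; left.
  - by move=> x y; rewrite /D D1_sym E_sym.
  - by move=> x y z; rewrite /D addrACA lerD // -natrD ler_nat.
have D_complete : is_complete D.
  move=> u u_cauchy.
  have [n|l lP] := cell_close_complete X1_invariant cellsE cells_separate (u := u).
    have [e e0 eP] := D1_close n; have [N NP] := u_cauchy e e0.
    exists N => k l Nk Nl; apply: eP.
    exact: le_lt_trans (NP k l Nk Nl).
  exists l; apply/cvgrPdist_le => e e0.
  have [n nP] := close_D1 e e0; have [N NP] := lP n.
  exists N => // k /= Nk; have close_kl := NP k Nk.
  rewrite sub0r normrN ger0_norm; last by rewrite addr_ge0.
  rewrite /D (E_close _ _).2 ?addr0; first exact: nP.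
  exact: (cell_close_mono X1_invariant _ close_kl).
have decr t : 0 < t -> exists2 r, r < t & exists2 d, 0 < d &
     forall i x y, D x y < t + d -> D (f i x) (f i y) <= r.
  move=> t0; have [|p /andP[p0 p1] pP] := D1_contr (t / 2); first by rewrite divr_gt0.
  have pt : 0 < p * t by rewrite mulr_gt0.
  (* Within the margin [p * t] the factor [1 - p] still brings the distance
     below [t], since (1 - p)(1 + p) < 1; within the margin 1/2 the unit lost
     by the entrance distance does. *)
  exists (Num.max (Num.max ((1 - p) * (t + p * t)) (t / 2)) (t - 1 / 2)).
    rewrite !gt_max -andbA; apply/and3P; split; [|lra|lra].
    rewrite [ltLHS](_ : _ = t - p * (p * t)); last by ring.
    by rewrite ltrBlDr ltrDl mulr_gt0.
  exists (Num.min (p * t) (1 / 2)); first by rewrite lt_min pt divr_gt0.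
  move=> i x y Dxy; rewrite le_max.
  have Dpt : D x y < t + p * t.
    by apply: lt_le_trans Dxy _; rewrite lerD2l ge_min lexx.
  have Dhalf : D x y < t + 1 / 2.
    by apply: lt_le_trans Dxy _; rewrite lerD2l ge_min lexx orbT.
  have [Exy|E_gt0] := posnP (E x y); apply/orP; [left|right]; last first.
    have : D (f i x) (f i y) <= D x y - 1.
      by rewrite /D -addrA lerD // -(@natrB R _ 1) // subn1 ler_nat.
    by move: Dhalf; lra.
  have fE : E (f i x) (f i y) = 0%N.
    by apply/eqP; rewrite -leqn0; apply: leq_trans (E_dec i x y) _; rewrite Exy.
  rewrite {1}/D fE addr0.
  apply: le_trans (pP i x y ((E_close x y).1 Exy)) _.
  rewrite ge_max !le_max lexx orbT andbT ler_wpM2l ?subr_ge0 //.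
  by apply: ltW; exact: le_lt_trans Dpt.
have [phi [phi_comp phi_contr]] :=
  comparison_of_strict_decrease (metric_ge0 D_metric) decr.
by exists D, phi; split.
Qed.

End remetrization.

(** * Iterates of a comparison function *)

Section comparison.
Context {R : realType} (phi : R -> R).
Hypothesis phi_comparison : is_comparison phi.

Lemma comparison_le t : 0 <= t -> phi t <= t.
Proof.
rewrite le_eqVlt => /predU1P[<-|/(comparison_lt phi_comparison)/ltW//].
apply/ler_addgt0Pr => e e0; rewrite add0r.
apply: le_trans (ltW (comparison_lt phi_comparison e0)).
by apply: (comparison_homo phi_comparison); rewrite ?lexx ?ltW.
Qed.

Lemma iter_comparison_ge0 n t : 0 <= t -> 0 <= iter n phi t.
Proof. by move=> t0; elim: n => //= n; exact: (comparison_ge0 phi_comparison). Qed.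

Lemma iter_comparison_anti t m n :
  0 <= t -> (m <= n)%N -> iter n phi t <= iter m phi t.
Proof.
move=> t0 /subnK <-; elim: (n - m)%N => //= k IH.
by apply: le_trans IH; apply: comparison_le; exact: iter_comparison_ge0.
Qed.

(** The iterates decrease; at a positive infimum [l], right continuity and
    [phi l < l] would push some iterate below [l]. *)
Lemma iter_comparison_small t e :
  0 <= t -> 0 < e -> exists n, iter n phi t < e.
Proof.
move=> t0 e0; apply: contrapT => /forallNP large.
pose S := [set iter n phi t | n in [set: nat]].
have S_neq0 : S !=set0 by exists t; exists 0%N.
have S_lb x : (forall n, x <= iter n phi t) -> lbound S x.
  by move=> xP _ [n _ <-].
have hasS : has_lbound S by exists 0; apply: S_lb => n; exact: iter_comparison_ge0.
pose l := inf S.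
have l_le n : l <= iter n phi t by apply: ge_inf => //; exists n.
have l0 : 0 < l.
  apply: lt_le_trans e0 _; apply: lb_le_inf => //; apply: S_lb => n.
  by rewrite leNgt; apply/negP/large.
have phil := comparison_lt phi_comparison l0.
have /cvgrPdist_lt /(_ (l - phi l)) := comparison_right_continuous phi_comparison (ltW l0).
rewrite subr_gt0 => /(_ phil) [d /= d0 dP].
have [_ [n _ <-] nd] := inf_adherent d0 (conj S_neq0 hasS).
have := l_le n.+1; rewrite leNgt => /negP; apply => /=.
move: (l_le n) nd; rewrite le_eqVlt => /predU1P[<- //|ln nd].
have := dP (iter n phi t) _ ln; rewrite ltr_norml => /(_ _)/andP[|+ _].
  by rewrite /ball_ /= ltr0_norm ?subr_lt0 // opprB ltrBlDl.
by rewrite ltrNl opprB ltrD2r.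
Qed.

End comparison.

(** * The absorbing set of a contractive system *)

Section absorbing_set.
Context {R : realType} {X : Type} {I : finType} (f : I -> X -> X).
Context (D : X -> X -> R) (phi : R -> R).
Hypothesis D_metric : is_metric D.
Hypothesis phi_comparison : is_comparison phi.
Hypothesis D_complete : is_complete D.
Hypothesis f_contraction : forall i, is_phi_contraction D phi (f i).

Let D_ge0 x y : 0 <= D x y. Proof. exact: metric_ge0 D_metric x y. Qed.
Let D_refl x : D x x = 0. Proof. exact/(metric_eq0 D_metric x x). Qed.
Let D_sym x y : D x y = D y x. Proof. exact: metric_symm D_metric x y. Qed.
Let D_triangle y x z : D x z <= D x y + D y z.
Proof. exact: metric_triangle_ineq D_metric x y z. Qed.

Lemma dist_word_fun w x y c : D x y <= c ->
  D (word_fun f w x) (word_fun f w y) <= iter (size w) phi c.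
Proof.
move=> xyc; elim: w => //= i w IH; apply: le_trans (f_contraction i _ _) _.
exact: (comparison_homo phi_comparison).
Qed.

Lemma eq_dist_small x y : (forall e, 0 < e -> D x y <= e) -> x = y.
Proof.
move=> xy; apply/(metric_eq0 D_metric); apply/eqP.
rewrite eq_le D_ge0 andbT; apply/ler_addgt0Pr => e e0; rewrite add0r.
exact: xy.
Qed.

(** The iterates of [phi] being small, the last letter of a long word hardly
    matters: for a suitable [n] the point of [x0] along a word of length
    [n.+1] is within [1 - phi 1] of the point along that word without its last
    letter.  Hence the closed 1-neighbourhood of the finitely many points along
    words of length [n] is invariant. *)
Lemma bounded_orbit (x0 : X) : (0 < #|I|)%N ->
  exists p M, 0 <= M /\ forall w, D p (word_fun f w p) <= M.
Proof.
move=> /card_gt0P[i0 _].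
pose M0 := \sum_i D x0 (f i x0).
have M0P i : D x0 (f i x0) <= M0.
  by rewrite /M0 (bigD1 i) //= lerDl sumr_ge0.
have M0_ge0 : 0 <= M0 by exact: sumr_ge0.
have phi1 := comparison_lt phi_comparison (ltr01 : 0 < (1 : R)).
have [n nP] : exists n, iter n phi M0 < 1 - phi 1.
  by apply: iter_comparison_small => //; rewrite subr_gt0.
pose U y := exists2 v, size v = n & D (word_fun f v x0) y <= 1.
have U_invariant i y : U y -> U (f i y).
  move=> [v sv vy].
  exists (belast i v); first by rewrite size_belast.
  apply: le_trans (D_triangle (word_fun f (i :: v) x0) _ _) _.
  rewrite -[leRHS](subrK (phi 1)); apply: lerD.
    rewrite lastI word_fun_rcons; apply: le_trans (ltW nP).
    by rewrite -sv -(size_belast i v); exact: dist_word_fun.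
  apply: le_trans (f_contraction i _ _) _.
  exact: (comparison_homo phi_comparison).
pose p := word_fun f (nseq n i0) x0.
have Up w : U (word_fun f w p).
  elim: w => [|i w]; last exact: U_invariant.
  by exists (nseq n i0); rewrite ?size_nseq // D_refl.
exists p, (\sum_(v : n.-tuple I) D p (word_fun f v x0) + 1); split.
  by rewrite addr_ge0 // sumr_ge0.
move=> w; have [v /eqP sv vw] := Up w.
apply: le_trans (D_triangle (word_fun f v x0) _ _) (lerD _ vw).
by rewrite (bigD1 (Tuple sv)) //= lerDl sumr_ge0.
Qed.

Context (p : X) (M : R).
Hypothesis M_ge0 : 0 <= M.
Hypothesis orbit_bounded : forall w, D p (word_fun f w p) <= M.

Lemma iter_small_eventually t e : 0 <= t -> 0 < e ->
  exists N, forall n, (N <= n)%N -> iter n phi t <= e.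
Proof.
move=> t0 e0; have [N /ltW Ne] := iter_comparison_small phi_comparison t0 e0.
by exists N => n Nn; apply: le_trans Ne; exact: iter_comparison_anti.
Qed.

Lemma addresses : exists a : infinite_word I -> X, forall alpha e, 0 < e ->
  exists N, forall n, (N <= n)%N ->
    D (word_fun f (prefix_word alpha n) p) (a alpha) <= e.
Proof.
suff /choice[a aP] (alpha : infinite_word I) : exists l, forall e, 0 < e ->
    exists N, forall n, (N <= n)%N ->
      D (word_fun f (prefix_word alpha n) p) l <= e by exists a.
have [|l lP] := D_complete (u := fun n => word_fun f (prefix_word alpha n) p).
  move=> e e0; have [|N NP] := iter_comparison_small phi_comparison _ e0 (t := M + M).
    by rewrite addr_ge0.
  exists N => m n Nm Nn; apply: le_lt_trans NP.
  rewrite -(cat_take_drop N (prefix_word alpha m)) take_prefix_word //.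
  rewrite -(cat_take_drop N (prefix_word alpha n)) take_prefix_word //.
  rewrite !word_fun_cat -[in leRHS](size_mkseq alpha N); apply: dist_word_fun.
  by apply: le_trans (D_triangle p _ _) _; rewrite lerD // D_sym.
exists l => e e0; have /cvgrPdist_le /(_ e e0) [N _ NP] := lP.
by exists N => n /NP; rewrite sub0r normrN ger0_norm.
Qed.

(** The point [a alpha] is the image of the point of the shifted word under the
    first map, so it lies in all the cells of [alpha]; that the cells shrink
    gives uniqueness and separation. *)
Lemma absorbing_set : (0 < #|I|)%N -> exists (X1 : set X) (a : infinite_word I -> X),
    [/\ hutchinson f X1 `<=` X1,
        forall alpha : infinite_word I,
          \bigcap_(n in [set: nat]) word_image f X1 (prefix_word alpha n)
            = [set a alpha],
        forall alpha beta : infinite_word I, a alpha <> a beta ->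
          exists n0 : nat,
            word_image f X1 (prefix_word alpha n0) `&`
            word_image f X1 (prefix_word beta n0) = set0 &
        forall x : X, exists nx : nat,
          iter nx (hutchinson f) [set x] `<=` X1].
Proof.
move=> /card_gt0P[i0 _]; have [a aP] := addresses.
have a_shift alpha : a alpha = f (alpha 0%N) (a (alpha \o succn)).
  apply: eq_dist_small => e e0; have e20 : 0 < e / 2 by rewrite divr_gt0.
  have [N NP] := aP alpha _ e20; have [N' N'P] := aP (alpha \o succn) _ e20.
  pose n := maxn N N'.
  apply: le_trans (D_triangle (word_fun f (prefix_word alpha n.+1) p) _ _) _.
  rewrite [e]splitr; apply: lerD.
    by rewrite D_sym NP // leqW // leq_maxl.
  rewrite prefix_wordS /=; apply: le_trans (f_contraction _ _ _) _.
  apply: le_trans (comparison_le phi_comparison _) _ => //.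
  by apply: N'P; exact: leq_maxr.
have a_cons i alpha : exists beta, f i (a alpha) = a beta.
  by exists (fun n => if n is k.+1 then alpha k else i); rewrite [RHS]a_shift.
have a_prefix n alpha :
    exists beta, a alpha = word_fun f (prefix_word alpha n) (a beta).
  elim: n alpha => [|n IH] alpha; first by exists alpha.
  have [beta aE] := IH (alpha \o succn); exists beta.
  by rewrite prefix_wordS /= -aE -a_shift.
have a_bounded alpha beta : D (a alpha) (a beta) <= (M + 1) + (M + 1).
  suff bnd gamma : D p (a gamma) <= M + 1.
    by apply: le_trans (D_triangle p _ _) _; rewrite lerD // D_sym.
  have [N NP] := aP gamma _ ltr01.
  apply: le_trans (D_triangle (word_fun f (prefix_word gamma N) p) _ _) _.
  by rewrite lerD // NP.
pose X1 := [set y | exists alpha, D y (a alpha) <= 1].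
pose C := 1 + ((M + 1) + (M + 1)) + 1.
have C_ge0 : 0 <= C by rewrite /C; move: M_ge0; lra.
have X1_bounded x y : X1 x -> X1 y -> D x y <= C.
  move=> [alpha xa] [beta yb]; apply: le_trans (D_triangle (a beta) _ _) _.
  rewrite lerD //; last by rewrite D_sym.
  by apply: le_trans (D_triangle (a alpha) _ _) _; rewrite lerD.
have a_X1 alpha : X1 (a alpha) by exists alpha; rewrite D_refl.
have cell_a alpha n : word_image f X1 (prefix_word alpha n) (a alpha).
  by have [beta aE] := a_prefix n alpha; exists (a beta).
have cell_small alpha e : 0 < e -> exists N, forall n, (N <= n)%N -> forall x y,
    word_image f X1 (prefix_word alpha n) x ->
    word_image f X1 (prefix_word alpha n) y -> D x y <= e.
  move=> e0; have [N NP] := iter_small_eventually C_ge0 e0.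
  exists N => n Nn _ _ [x X1x <-] [y X1y <-].
  apply: le_trans (NP n Nn); rewrite -[in leRHS](size_mkseq alpha n).
  by apply: dist_word_fun; exact: X1_bounded.
exists X1, a; split.
- move=> _ [i _ [y [alpha ya] <-]]; have [beta aE] := a_cons i alpha.
  exists beta; rewrite -aE; apply: le_trans (f_contraction _ _ _) _.
  exact: le_trans (comparison_le phi_comparison _) ya.
- move=> alpha; apply/seteqP; split=> [y yP|_ -> n _]; last exact: cell_a.
  apply: eq_dist_small => e e0; have [N NP] := cell_small alpha e e0.
  by apply: (NP N) => //; exact: yP.
- move=> alpha beta ab; apply: contrapT => /forallNP meet; apply: ab.
  apply: eq_dist_small => e e0; have e20 : 0 < e / 2 by rewrite divr_gt0.
  have [N NP] := cell_small alpha _ e20; have [N' N'P] := cell_small beta _ e20.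
  have /eqP/set0P[z [za zb]] := meet (maxn N N').
  apply: le_trans (D_triangle z _ _) _; rewrite [e]splitr; apply: lerD.
    by apply: (NP (maxn N N')) => //; exact: leq_maxl.
  by apply: (N'P (maxn N N')) => //; exact: leq_maxr.
- move=> x; pose alpha : infinite_word I := fun=> i0.
  have [n nP] := iter_comparison_small phi_comparison (D_ge0 x (a alpha))
    (ltr01 : 0 < (1 : R)).
  exists n; rewrite iter_hutchinson => y [w sw [_ -> <-]].
  have [beta aE] : exists beta, word_fun f w (a alpha) = a beta.
    elim: w {sw} => [|i w [beta /= ->]]; first by exists alpha.
    exact: a_cons.
  exists beta; rewrite -aE; apply: le_trans (ltW nP).
  by rewrite -sw; exact: dist_word_fun.
Qed.

End absorbing_set.

(** * The equivalence *)

Theorem theorem4p1 (R : realType) (X : Type) (hX : inhabited X)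
    (I : finType) (hI : (0 < #|I|)%N) (f : I -> X -> X) :
  (exists (D : X -> X -> R) (phi : R -> R),
    [/\ is_metric D,
        is_comparison phi,
        is_complete D &
        forall i : I, is_phi_contraction D phi (f i)])
  <->
  (exists (X1 : set X) (a : infinite_word I -> X),
    [/\ hutchinson f X1 `<=` X1,
        forall alpha : infinite_word I,
          \bigcap_(n in [set: nat]) word_image f X1 (prefix_word alpha n)
            = [set a alpha],
        forall alpha beta : infinite_word I, a alpha <> a beta ->
          exists n0 : nat,
            word_image f X1 (prefix_word alpha n0) `&`
            word_image f X1 (prefix_word beta n0) = set0 &
        forall x : X, exists nx : nat,
          iter nx (hutchinson f) [set x] `<=` X1]).
Proof.
split=> [[D [phi [D_metric phi_comp D_complete f_contr]]]|].
  case: hX => x0.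
  have [p [M [M0 pM]]] := bounded_orbit D_metric phi_comp f_contr x0 hI.
  exact: (absorbing_set D_metric phi_comp D_complete f_contr M0 pM hI).
move=> [X1 [a [X1_inv cells sep absorb]]].
exact: (remetrization X1_inv cells sep absorb).
Qed.
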